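(* Let a quantum resource theory with set of free operations $\mathbb{F}$ and resource measure $M$ be given, and let $\mathcal{N}_t\in\mathbb{F}$ be a free (relaxation) operation. Suppose that the operation Mpemba effect occurs for $\mathcal{N}_t$, i.e. there exist a parameter set $\Lambda\subset\mathbb{R}$ and a resource-Markovian dynamics $(\mathcal{E}_\lambda)_{\lambda\in\Lambda}$ such that the induced dynamics $(\mathcal{N}_t\circ\mathcal{E}_\lambda)_{\lambda\in\Lambda}$ is not resource-Markovian in $\lambda$. Then there exists a family of initial states $(\rho_\lambda)_{\lambda\in\Lambda}$ that exhibits a resource Mpemba effect under $\mathcal{N}_t$; that is, $M(\rho_{\lambda})\ge M(\rho_{\lambda'})$ for all $\lambda<\lambda'$ in $\Lambda$, and there exist $\lambda_1<\lambda_2$ in $\Lambda$ with $$M(\mathcal{N}_t(\rho_{\lambda_1}))<M(\mathcal{N}_t(\rho_{\lambda_2})).$$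
   Context: States are density operators on a Hilbert space. A resource theory consists of a set $\mathbb{F}$ of quantum operations (the free operations), containing the identity and closed under composition, together with a real-valued resource measure $M$ on states that is monotone under free operations: $M(\mathcal{F}(\rho))\le M(\rho)$ for every state $\rho$ and every $\mathcal{F}\in\mathbb{F}$. A dynamics is a family $(\mathcal{E}_\lambda)_{\lambda\in\Lambda}$ of free operations indexed by a real parameter $\lambda\in\Lambda\subset\mathbb{R}$ (continuous or discrete). It is called resource-Markovian if for all $\lambda_1<\lambda_2$ in $\Lambda$ and every state $\rho$, $M(\mathcal{E}_{\lambda_1}(\rho))\ge M(\mathcal{E}_{\lambda_2}(\rho))$. A family of states $(\rho_\lambda)_{\lambda\in\Lambda}$ is resource-monotonic if $M(\rho_{\lambda_1})\ge M(\rho_{\lambda_2})$ whenever $\lambda_1<\lambda_2$. A resource-monotonic family exhibits a (state-based) resource Mpemba effect under a free operation $\mathcal{N}$ if there exist $\lambda_1<\lambda_2$ with $M(\mathcal{N}(\rho_{\lambda_1}))<M(\mathcal{N}(\rho_{\lambda_2}))$. The operation Mpemba effect occurs for a free operation $\mathcal{N}$ if there is a resource-Markovian dynamics $(\mathcal{E}_\lambda)$ such that $(\mathcal{N}\circ\mathcal{E}_\lambda)$ is not resource-Markovian in $\lambda$. *)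

(* Defs.v *)
From HB Require Import structures.
From mathcomp Require Import all_boot all_order all_algebra sesquilinear.
From mathcomp Require Import complex ring.
From mathcomp Require Import boolp classical_sets functions reals topology normedtype.
From mathcomp.analysis.showcase Require Import summability.

Set Implicit Arguments.
Unset Strict Implicit.
Unset Printing Implicit Defensive.

Import Order.TTheory GRing.Theory Num.Theory.
Import numFieldNormedType.Exports.

Local Open Scope classical_set_scope.
Local Open Scope ring_scope.

(* As in sesquilinear.v, forms are linear in their first argument and
   conjugate-linear in the second one. *)
HB.mixin Record CompleteNormedModule_isHilbert (R : realType) H
    & CompleteNormedModule R[i] H := {
  inner : {dot H for @Num.conj R[i]} ;
  inner_norm : forall x : H, inner x x = `|x| ^+ 2
}.

#[short(type="hilbertType")]
HB.structure Definition Hilbert (R : realType) :=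
  { H of CompleteNormedModule_isHilbert R H & CompleteNormedModule R[i] H }.

Section Operators.
Context {R : realType} {H : hilbertType R}.
Implicit Types (S T P rho : H -> H) (B : set H).

Local Notation "''[' x , y ]" := (inner x y).

Definition bounded_op T : Prop := linear T /\ continuous T.

(* The order of R[i] makes 0 <= z entail that z is real. *)
Definition positive_op T : Prop := bounded_op T /\ forall x, 0 <= '[T x, x].

Definition is_adjoint T S : Prop :=
  bounded_op S /\ forall x y, '[T x, y] = '[x, S y].

(* P = |T| = sqrt (T^* T) *)
Definition is_abs T P : Prop :=
  positive_op P /\ exists2 S, is_adjoint T S & P \o P = S \o T.

Definition orthonormal_basis B : Prop :=
  [/\ forall e, B e -> '[e, e] = 1,
      forall e f, B e -> B f -> e <> f -> '[e, f] = 0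
    & forall x, (forall e, B e -> '[x, e] = 0) -> x = 0].

(* tr T = t; the sum over the basis is the limit of the net of its finite
   partial sums, so that H need not be separable. *)
Definition has_trace T (t : R[i]) : Prop :=
  forall B, orthonormal_basis B ->
    partial_sum (fun e : B => '[T (val e), val e] : R[i]^o) @ totally
      --> (t : R[i]^o).

Definition trace_class_op T : Prop :=
  bounded_op T /\ exists P t, is_abs T P /\ has_trace P t.

Definition density_op rho : Prop := positive_op rho /\ has_trace rho 1.

End Operators.

Record traceClass (R : realType) (H : hilbertType R) := TraceClass {
  trace_class_fun :> H -> H ;
  trace_classP : trace_class_op trace_class_fun
}.

Record density (R : realType) (H : hilbertType R) := Density {
  density_fun :> H -> H ;
  densityP : density_op density_fun
}.

Section Channels.
Context {R : realType} {H : hilbertType R}.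

(* Linearity of a map between trace class operators; U stands for a *: S + T,
   which is always trace class. *)
Definition tc_linear (Phi : traceClass H -> traceClass H) : Prop :=
  forall (a : R[i]) (S T U : traceClass H),
    (forall x, U x = a *: S x + T x) ->
    forall x, Phi U x = a *: Phi S x + Phi T x.

(* Positivity of the operator matrix (T i j) acting on the n-fold direct sum
   of H, i.e. on C^n (x) H. *)
Definition block_positive n (T : 'I_n -> 'I_n -> traceClass H) : Prop :=
  forall x : 'I_n -> H, 0 <= \sum_i \sum_j inner (T i j (x j)) (x i).

Definition completely_positive (Phi : traceClass H -> traceClass H) : Prop :=
  forall n (T : 'I_n -> 'I_n -> traceClass H),
    block_positive T -> block_positive (fun i j => Phi (T i j)).

Definition trace_preserving (Phi : traceClass H -> traceClass H) : Prop :=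
  forall (T : traceClass H) t, has_trace T t -> has_trace (Phi T) t.

End Channels.

Record channel (R : realType) (H : hilbertType R) := Channel {
  channel_fun :> traceClass H -> traceClass H ;
  channel_linear : tc_linear channel_fun ;
  channel_cp : completely_positive channel_fun ;
  channel_tp : trace_preserving channel_fun
}.

Section ChannelOps.
Context {R : realType} {H : hilbertType R}.

Lemma positive_op_sym (T : H -> H) : positive_op T ->
  forall x y, inner (T x) y = inner x (T y).
Proof.
move=> [[linT _] posT] x y.
have TD u v : T (u + v) = T u + T v by have := linT 1 u v; rewrite !scale1r.
have T0 : T 0 = 0 by apply: (addrI (T 0)); rewrite -TD !addr0.
have TZ a u : T (a *: u) = a *: T u by have := linT a u 0; rewrite T0 !addr0.
have diag u : inner (T u) u = inner u (T u).
  rewrite [RHS](@hermC _ _ _ _ (@inner R H)) expr0 mul1r.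
  exact: (esym (geC0_conj (posT u))).
pose b u v := inner (T u) v - inner u (T v).
have b0 u : b u u = 0 by rewrite /b diag subrr.
have bD u v : b u v + b v u = 0.
  rewrite -[RHS](b0 (u + v)) -[LHS]addr0 -(b0 u) -[LHS]addr0 -(b0 v).
  by rewrite /b !TD !(linearDl, linearDr); ring.
have bl a u v : b (a *: u) v = a * b u v.
  by rewrite /b TZ !linearZl_LR mulrBr.
have br a u v : b u (a *: v) = a^*%R * b u v.
  by rewrite /b TZ !linearZr_LR mulrBr.
have bN : b y x = b x y.
  have := bD x ('i%R *: y); rewrite bl br conjCi mulNr addrC -mulrBr => /eqP.
  by rewrite mulf_eq0 (negbTE (neq0Ci R[i])) subr_eq0 => /eqP.
have := bD x y; rewrite bN -mulr2n => /eqP; rewrite mulrn_eq0 /=.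
by rewrite subr_eq0 => /eqP.
Qed.

Lemma density_trace_class (rho : density H) : trace_class_op rho.
Proof.
have [posr tr1] := densityP rho; split; first exact: posr.1.
exists rho, 1; split=> //; split=> //; exists rho => //.
by split; [exact: posr.1 | exact: positive_op_sym].
Qed.

Definition density_tc (rho : density H) : traceClass H :=
  TraceClass (density_trace_class rho).

Lemma channel_density (Phi : channel H) (rho : density H) :
  density_op (Phi (density_tc rho)).
Proof.
have [posr tr1] := densityP rho.
split; last exact: (@channel_tp _ _ Phi (density_tc rho)).
split; first exact: (trace_classP _).1.
move=> x.
have /(channel_cp Phi)/(_ (fun=> x)) :
    block_positive (fun _ _ : 'I_1 => density_tc rho).
  by move=> y; rewrite !big_ord1; exact: posr.2.
by rewrite !big_ord1.
Qed.

Definition channel_app (Phi : channel H) (rho : density H) : density H :=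
  Density (channel_density Phi rho).

Lemma idc_linear : tc_linear (@id (traceClass H)). Proof. by []. Qed.
Lemma idc_cp : completely_positive (@id (traceClass H)). Proof. by []. Qed.
Lemma idc_tp : trace_preserving (@id (traceClass H)). Proof. by []. Qed.

Definition idc : channel H := Channel idc_linear idc_cp idc_tp.

Variables Phi Psi : channel H.

Lemma compc_linear : tc_linear (Phi \o Psi).
Proof. by move=> a S T U /(channel_linear Psi)/(channel_linear Phi). Qed.

Lemma compc_cp : completely_positive (Phi \o Psi).
Proof. by move=> n T /(channel_cp Psi)/(channel_cp Phi). Qed.

Lemma compc_tp : trace_preserving (Phi \o Psi).
Proof. by move=> T t /(channel_tp Psi)/(channel_tp Phi). Qed.

Definition compc : channel H := Channel compc_linear compc_cp compc_tp.

End ChannelOps.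

Record resourceTheory (R : realType) (H : hilbertType R) := ResourceTheory {
  free_ops : set (channel H) ;
  resource_measure : density H -> R ;
  free_ops_id : free_ops idc ;
  free_ops_comp : forall Phi Psi,
    free_ops Phi -> free_ops Psi -> free_ops (compc Phi Psi) ;
  resource_measure_monotone : forall Phi, free_ops Phi -> forall rho,
    resource_measure (channel_app Phi rho) <= resource_measure rho
}.

Section Mpemba.
Context {R : realType} {H : hilbertType R} (X : resourceTheory H).
Context {Lambda : set R}.
Implicit Types (E : Lambda -> channel H) (rho : Lambda -> density H).

Local Notation M := (resource_measure X).

Definition dynamics E : Prop := forall l, free_ops X (E l).

Definition resource_Markovian E : Prop :=
  forall l1 l2 : Lambda, val l1 < val l2 ->
  forall sigma, M (channel_app (E l2) sigma) <= M (channel_app (E l1) sigma).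

Definition resource_monotonic rho : Prop :=
  forall l1 l2 : Lambda, val l1 < val l2 -> M (rho l2) <= M (rho l1).

Definition state_Mpemba (N : channel H) rho : Prop :=
  resource_monotonic rho /\
  exists l1 l2 : Lambda, val l1 < val l2 /\
    M (channel_app N (rho l1)) < M (channel_app N (rho l2)).

Definition operation_Mpemba (N : channel H) E : Prop :=
  [/\ dynamics E, resource_Markovian E
    & ~ resource_Markovian (fun l => compc N (E l))].

End Mpemba.

(* Main.v *)
Require Import Defs.
From mathcomp Require Import all_boot all_order all_algebra.
From mathcomp Require Import boolp classical_sets reals.

(** Non-Markovianity of the induced dynamics is witnessed by a single state [sigma] and two
    parameters. The orbit of [sigma] under [E] is the desired family: it is monotonic as [E] is
    Markovian, and by [channel_app_comp] the witness is a strict inversion after [N]. *)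

Lemma traceClass_eq (R : realType) (H : hilbertType R) (S T : traceClass H) :
  trace_class_fun S = trace_class_fun T -> S = T.
Proof.
case: S T => [S HS] [T HT] /= eST; rewrite eST in HS *.
by rewrite (Prop_irrelevance HS HT).
Qed.

Lemma density_eq (R : realType) (H : hilbertType R) (rho sigma : density H) :
  density_fun rho = density_fun sigma -> rho = sigma.
Proof.
case: rho sigma => [S HS] [T HT] /= eST; rewrite eST in HS *.
by rewrite (Prop_irrelevance HS HT).
Qed.

(* Not convertible: the trace class operators fed to Phi on the two sides carry
   different proofs of trace_class_op. *)
Lemma channel_app_comp (R : realType) (H : hilbertType R) (Phi Psi : channel H)
    (rho : density H) :
  channel_app (compc Phi Psi) rho = channel_app Phi (channel_app Psi rho).
Proof.
apply: density_eq => /=; congr (trace_class_fun (Phi _)).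
exact: traceClass_eq.
Qed.

Theorem proposition1 (R : realType) (H : hilbertType R) (X : resourceTheory H)
    (N : channel H) (hN : free_ops X N) (Lambda : set R) (E : Lambda -> channel H)
    (hE : operation_Mpemba X N E) :
  exists rho : Lambda -> density H, state_Mpemba X N rho.
Proof.
have [_ markovE /existsNP[l1 /existsNP[l2 /not_implyP[lt12 /existsNP[sigma]]]]] :=
  hE.
(* The measure takes real values, so a failed [<=] is a strict reverse inequality. *)
rewrite !channel_app_comp => /negP; rewrite -Order.TotalTheory.ltNge => ltM.
exists (fun l => channel_app (E l) sigma); split; last by exists l1, l2.
by move=> k1 k2 lt_k; exact: markovE.
Qed.
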